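(* Every semiprime algebra $\mathcal{A}$ is strongly associative; that is, for any group $G$ and an arbitrary partial action $\alpha$ of $G$ on $\mathcal{A}$, the skew group ring $\mathcal{A}\rtimes_\alpha G$ is associative.
   Context: Let $K$ be a field. An algebra means an associative $K$-algebra, not necessarily unital; ideals are two-sided. A semiprime algebra is, by definition, a unital algebra having no non-zero nilpotent ideal. A partial action $\alpha$ of a group $G$ (with identity $1$) on an algebra $\mathcal{A}$ is a collection of ideals $\mathcal{D}_g$ of $\mathcal{A}$ $(g\in G)$ and algebra isomorphisms $\alpha_g:\mathcal{D}_{g^{-1}}\to\mathcal{D}_g$ such that: (i) $\mathcal{D}_1=\mathcal{A}$ and $\alpha_1$ is the identity map of $\mathcal{A}$; (ii) $\mathcal{D}_{(gh)^{-1}}\supseteq \alpha_h^{-1}(\mathcal{D}_h\cap\mathcal{D}_{g^{-1}})$ for all $g,h\in G$; (iii) $\alpha_g\circ\alpha_h(x)=\alpha_{gh}(x)$ for each $x\in\alpha_h^{-1}(\mathcal{D}_h\cap\mathcal{D}_{g^{-1}})$. The skew group ring $\mathcal{A}\rtimes_\alpha G$ is the set of all finite formal sums $\sum_{g\in G}a_g\delta_g$ with $a_g\in\mathcal{D}_g$, where the $\delta_g$ are symbols, with the obvious addition and with (bilinear) multiplication determined by $(a_g\delta_g)\cdot(b_h\delta_h)=\alpha_g(\alpha_{g^{-1}}(a_g)b_h)\delta_{gh}$. It is a priori a not necessarily associative algebra. *)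

(* Defs.v *)
From HB Require Import structures.
From mathcomp Require Import all_boot all_order all_algebra.
From mathcomp Require Import boolp classical_sets functions cardinality fsbigop.

Set Implicit Arguments.
Unset Strict Implicit.
Unset Printing Implicit Defensive.
Import GRing.Theory.
Local Open Scope classical_set_scope.
Local Open Scope ring_scope.

(* Associative algebras, not necessarily unital; [algType K] would impose a unit
   [1 != 0], and so exclude the zero algebra. *)
HB.mixin Record isNuAlgebra (K : fieldType) A of GRing.Lmodule K A := {
  amul : A -> A -> A;
  amulA : associative amul;
  amulDl : left_distributive amul +%R;
  amulDr : right_distributive amul +%R;
  ascalerAl : forall (c : K) (x y : A), c *: amul x y = amul (c *: x) y;
  ascalerAr : forall (c : K) (x y : A), c *: amul x y = amul x (c *: y)
}.

#[short(type="nuAlgType")]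
HB.structure Definition NuAlgebra (K : fieldType) :=
  {A of isNuAlgebra K A & GRing.Lmodule K A}.

Notation "x ** y" := (amul x y) (at level 40, left associativity) : ring_scope.

Section Ideals.
Context {K : fieldType} {A : nuAlgType K}.

Record is_ideal (I : set A) : Prop := IsIdeal {
  ideal0 : I 0;
  idealD : forall x y, I x -> I y -> I (x + y);
  idealZ : forall (c : K) x, I x -> I (c *: x);
  idealMl : forall a x, I x -> I (a ** x);
  idealMr : forall a x, I x -> I (x ** a)
}.

Definition ideal_mul (I J : set A) : set A :=
  [set x | exists s : seq (A * A),
    (forall p, p \in s -> I p.1 /\ J p.2) /\ x = \sum_(p <- s) p.1 ** p.2].

(* [ideal_expS I n] is the power I^(n+1). *)
Definition ideal_expS (I : set A) (n : nat) : set A :=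
  iter n (fun J => ideal_mul J I) I.

Definition nilpotent_ideal (I : set A) : Prop :=
  exists n : nat, ideal_expS I n = [set 0].

(* Isomorphism of algebras from the ideal [I] onto the ideal [J]; the values of
   [f] outside [I] are irrelevant. *)
Record is_ideal_iso (I J : set A) (f : A -> A) : Prop := IsIdealIso {
  iso_bij : set_bij I J f;
  isoD : forall x y, I x -> I y -> f (x + y) = f x + f y;
  isoZ : forall (c : K) x, I x -> f (c *: x) = c *: f x;
  isoM : forall x y, I x -> I y -> f (x ** y) = f x ** f y
}.

Lemma amul0r (x : A) : 0 ** x = 0.
Proof. by apply: (addrI (0 ** x)); rewrite -amulDl !addr0. Qed.

Lemma amulr0 (x : A) : x ** 0 = 0.
Proof. by apply: (addrI (x ** 0)); rewrite -amulDr !addr0. Qed.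

End Ideals.

Definition unital {K : fieldType} (A : nuAlgType K) : Prop :=
  exists e : A, forall x : A, e ** x = x /\ x ** e = x.

Definition semiprime {K : fieldType} (A : nuAlgType K) : Prop :=
  unital A /\
  forall I : set A, is_ideal I -> nilpotent_ideal I -> I = [set 0].

Section PartialActions.
Context {K : fieldType} (G : groupType) (A : nuAlgType K).
Implicit Types g h : G.

(* [a h] stands for an isomorphism [D h^-1 -> D h]; the preimage of [Y] under it
   is taken inside its domain [D h^-1]. *)
Definition pact_pre (D : G -> set A) (a : G -> A -> A) h (Y : set A) : set A :=
  D h^-1%g `&` a h @^-1` Y.

Record partial_action := PartialAction {
  pdom : G -> set A;
  pact : G -> A -> A;
  pdom_ideal : forall g, is_ideal (pdom g);
  pact_iso : forall g, is_ideal_iso (pdom g^-1%g) (pdom g) (pact g);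
  pdom1 : pdom 1%g = setT;
  pact1 : forall x, pact 1%g x = x;
  pact_pre_sub : forall g h,
    pact_pre pdom pact h (pdom h `&` pdom g^-1%g) `<=` pdom (g * h)^-1%g;
  pactM : forall g h x,
    pact_pre pdom pact h (pdom h `&` pdom g^-1%g) x ->
    pact g (pact h x) = pact (g * h)%g x
}.

End PartialActions.

Section SkewGroupRing.
Context {K : fieldType} {G : groupType} {A : nuAlgType K}.
Variable alpha : partial_action G A.
Implicit Types g h : G.
Local Notation D := (pdom alpha).

Definition coef_supp (f : G -> A) : set G := [set g | f g != 0].

(* The formal sum [\sum_g a_g delta_g] is encoded by its coefficients. *)
Definition skew_pred : {pred (G -> A)} :=
  [pred f : G -> A | `[< finite_set (coef_supp f) /\ forall g, D g (f g) >]].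

Lemma skew_predP (f : G -> A) :
  reflect (finite_set (coef_supp f) /\ forall g, D g (f g)) (f \in skew_pred).
Proof. exact: asboolP. Qed.

Lemma skew_submod : submod_closed skew_pred.
Proof.
split=> [|c u v /skew_predP[fu Du] /skew_predP[fv Dv]]; apply/skew_predP; split.
- suff -> : coef_supp 0 = set0 by exact: finite_set0.
  by apply/seteqP; split=> g //=; rewrite /coef_supp /= eqxx.
- by move=> g; exact: ideal0 (pdom_ideal alpha g).
- apply: (@sub_finite_set _ _ (coef_supp u `|` coef_supp v)); last first.
    by rewrite finite_setU.
  move=> g /=; rewrite /coef_supp /=; apply: contra_neqP => /not_orP[].
  move=> /negP/negPn/eqP ug /negP/negPn/eqP vg.
  by change (c *: u g + v g = 0); rewrite ug vg scaler0 addr0.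
- move=> g; have I := pdom_ideal alpha g.
  by apply: (idealD I) => //; exact: idealZ.
Qed.

HB.instance Definition _ :=
  GRing.isSubmodClosed.Build K (G -> A) skew_pred skew_submod.

Record skew_ring := SkewRing { coef :> G -> A; coefP : coef \in skew_pred }.

HB.instance Definition _ := [isSub for coef].
HB.instance Definition _ := [Choice of skew_ring by <:].
HB.instance Definition _ := [SubChoice_isSubLmodule of skew_ring by <:].

Definition monomial g (a : A) : G -> A := fun k => if k == g then a else 0.

Lemma monomial_in g a : D g a -> monomial g a \in skew_pred.
Proof.
move=> Da; apply/skew_predP; split=> [|k].
  apply: (@sub_finite_set _ _ [set g]); last exact: finite_set1.
  by move=> k /=; apply: contra_neqP => /eqP/negPf; rewrite /monomial => ->.
rewrite /monomial; case: eqP => [->//|_]; exact: ideal0 (pdom_ideal alpha k).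
Qed.

Definition delta g a (Da : D g a) : skew_ring := SkewRing (monomial_in Da).

(* The coefficient of [(a delta_g) (b delta_h)] at [delta_(g h)]. *)
Definition skew_coef g h (a b : A) : A :=
  pact alpha g (pact alpha g^-1%g a ** b).

Lemma pact_in g x : D g^-1%g x -> D g (pact alpha g x).
Proof. by case: (iso_bij (pact_iso alpha g)) => + _ _; exact. Qed.

Lemma pactV_in g x : D g x -> D g^-1%g (pact alpha g^-1%g x).
Proof. by move=> Dx; apply: pact_in; rewrite invgK. Qed.

Lemma skew_coef_in g h a b : D g a -> D h b -> D (g * h)%g (skew_coef g h a b).
Proof.
move=> Da Db; rewrite /skew_coef; set c := pact alpha g^-1%g a.
have Dc : D g^-1%g c by exact: pactV_in.
have Dcb : D g^-1%g (c ** b) by apply: idealMr Dc; exact: pdom_ideal.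
have Dcb' : D h (c ** b) by apply: idealMl Db; exact: pdom_ideal.
have Dd := pact_in Dcb.
have Vd : pact alpha g^-1%g (pact alpha g (c ** b)) = c ** b.
  by rewrite pactM ?mulVg ?pact1 //; split=> //; split=> //; rewrite invgK.
rewrite -[(g * h)%g]invgK invgM; apply: (@pact_pre_sub _ _ _ alpha).
split; first by rewrite invgK.
by rewrite /= Vd; split=> //; rewrite invgK.
Qed.

Definition skew_mul_fun (x y : skew_ring) : G -> A :=
  \sum_(g \in coef_supp x) \sum_(h \in coef_supp y)
     monomial (g * h)%g (skew_coef g h (x g) (y h)).

Lemma coef_in (x : skew_ring) g : D g (x g).
Proof. by case/skew_predP: (coefP x). Qed.

Lemma skew_mul_in (x y : skew_ring) : skew_mul_fun x y \in skew_pred.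
Proof.
apply: rpred_sum => g _; apply: rpred_sum => h _.
by apply: monomial_in; apply: skew_coef_in; exact: coef_in.
Qed.

Definition skew_mul (x y : skew_ring) : skew_ring := SkewRing (skew_mul_in x y).

Lemma skew_coefDl g h a a' b : D g a -> D g a' -> D h b ->
  skew_coef g h (a + a') b = skew_coef g h a b + skew_coef g h a' b.
Proof.
move=> Da Da' Db; rewrite /skew_coef (isoD (pact_iso _ _)) ?invgK// amulDl.
by rewrite (isoD (pact_iso _ _))//;
   apply: idealMr (pdom_ideal _ _) _ _ (pactV_in _).
Qed.

Lemma skew_coefDr g h a b b' : D g a -> D h b -> D h b' ->
  skew_coef g h a (b + b') = skew_coef g h a b + skew_coef g h a b'.
Proof.
move=> Da Db Db'; rewrite /skew_coef amulDr.
by rewrite (isoD (pact_iso _ _))//;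
   apply: idealMr (pdom_ideal _ _) _ _ (pactV_in _).
Qed.

Lemma skew_coefZl g h (c : K) a b : D g a -> D h b ->
  skew_coef g h (c *: a) b = c *: skew_coef g h a b.
Proof.
move=> Da Db; rewrite /skew_coef (isoZ (pact_iso _ _)) ?invgK// -ascalerAl.
by rewrite (isoZ (pact_iso _ _))//;
   apply: idealMr (pdom_ideal _ _) _ _ (pactV_in _).
Qed.

Lemma skew_coefZr g h (c : K) a b : D g a -> D h b ->
  skew_coef g h a (c *: b) = c *: skew_coef g h a b.
Proof.
move=> Da Db; rewrite /skew_coef -ascalerAr.
by rewrite (isoZ (pact_iso _ _))//;
   apply: idealMr (pdom_ideal _ _) _ _ (pactV_in _).
Qed.

Lemma pdom0 g : D g 0. Proof. exact: ideal0 (pdom_ideal alpha g). Qed.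

Lemma skew_coef0l g h b : D h b -> skew_coef g h 0 b = 0.
Proof.
by move=> Db; rewrite -(scale0r (0 : A)) skew_coefZl ?scale0r//; exact: pdom0.
Qed.

Lemma skew_coef0r g h a : D g a -> skew_coef g h a 0 = 0.
Proof.
by move=> Da; rewrite -(scale0r (0 : A)) skew_coefZr ?scale0r//; exact: pdom0.
Qed.

Lemma monomial0 g : monomial g 0 = 0.
Proof. by apply/funext => k; rewrite /monomial; case: ifP. Qed.

Lemma monomialD g a b : monomial g (a + b) = monomial g a + monomial g b.
Proof.
apply/funext => k; change (monomial g (a + b) k = monomial g a k + monomial g b k).
by rewrite /monomial; case: (k == g); rewrite ?addr0.
Qed.

Lemma monomialZ g (c : K) a : monomial g (c *: a) = c *: monomial g a.
Proof.
apply/funext => k; change (monomial g (c *: a) k = c *: monomial g a k).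
by rewrite /monomial; case: (k == g); rewrite ?scaler0.
Qed.

Lemma coef_supp_fin (x : skew_ring) : finite_set (coef_supp x).
Proof. by case/skew_predP: (coefP x). Qed.

Lemma skew_mulE (x y : skew_ring) (s t : seq G) :
    uniq s -> uniq t ->
    coef_supp x `<=` [set` s] -> coef_supp y `<=` [set` t] ->
  skew_mul x y = \sum_(g <- s) \sum_(h <- t)
     monomial (g * h)%g (skew_coef g h (x g) (y h)) :> (G -> A).
Proof.
move=> us ut xs yt; rewrite /= /skew_mul_fun.
rewrite (@fsbig_widen _ _ _ _ (coef_supp x) [set` s])//=; last first.
  move=> g [_ /= /negP/negPn/eqP xg0]; apply: big1 => h _.
  by rewrite xg0 skew_coef0l ?monomial0//; exact: coef_in.
rewrite -fsbig_seq//; apply: eq_bigr => g _.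
rewrite (@fsbig_widen _ _ _ _ (coef_supp y) [set` t])//=; last first.
  move=> h [_ /= /negP/negPn/eqP yh0].
  by rewrite yh0 skew_coef0r ?monomial0//; exact: coef_in.
by rewrite -fsbig_seq.
Qed.

Lemma coef_supp_seq (X : seq skew_ring) :
  exists2 s : seq G, uniq s & forall x, x \in X -> coef_supp x `<=` [set` s].
Proof.
elim: X => [|x X [s us sX]]; first by exists [::].
have /finite_seqP[t xt] := coef_supp_fin x.
exists (undup (t ++ s)) => [|y]; first exact: undup_uniq.
rewrite inE => /predU1P[->|yX] g /= gy; rewrite mem_undup mem_cat.
  by have : [set` t] g by [rewrite -xt]; move=> /= ->.
by have /= -> := sX y yX g gy; rewrite orbT.
Qed.

Lemma skew_mulDl : left_distributive skew_mul +%R.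
Proof.
move=> x y z; apply: val_inj.
change (coef (skew_mul (x + y) z) =
        coef (skew_mul x z) + coef (skew_mul y z)).
have [s us sX] := coef_supp_seq [:: x; y; z; x + y].
rewrite !(skew_mulE us us) -?big_split; do ?[by apply: sX; rewrite !inE eqxx ?orbT].
apply: eq_bigr => g _; rewrite -big_split; apply: eq_bigr => h _ /=.
by rewrite -monomialD -skew_coefDl//; exact: coef_in.
Qed.

Lemma skew_mulDr : right_distributive skew_mul +%R.
Proof.
move=> x y z; apply: val_inj.
change (coef (skew_mul x (y + z)) =
        coef (skew_mul x y) + coef (skew_mul x z)).
have [s us sX] := coef_supp_seq [:: x; y; z; y + z].
rewrite !(skew_mulE us us) -?big_split; do ?[by apply: sX; rewrite !inE eqxx ?orbT].
apply: eq_bigr => g _; rewrite -big_split; apply: eq_bigr => h _ /=.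
by rewrite -monomialD -skew_coefDr//; exact: coef_in.
Qed.

Lemma skew_mulZl (c : K) x y : skew_mul (c *: x) y = c *: skew_mul x y.
Proof.
apply: val_inj.
change (coef (skew_mul (c *: x) y) = c *: coef (skew_mul x y)).
have [s us sX] := coef_supp_seq [:: x; y; c *: x].
rewrite !(skew_mulE us us) ?scaler_sumr; do ?[by apply: sX; rewrite !inE eqxx ?orbT].
apply: eq_bigr => g _; rewrite scaler_sumr; apply: eq_bigr => h _ /=.
by rewrite -monomialZ -skew_coefZl//; exact: coef_in.
Qed.

Lemma skew_mulZr (c : K) x y : skew_mul x (c *: y) = c *: skew_mul x y.
Proof.
apply: val_inj.
change (coef (skew_mul x (c *: y)) = c *: coef (skew_mul x y)).
have [s us sX] := coef_supp_seq [:: x; y; c *: y].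
rewrite !(skew_mulE us us) ?scaler_sumr; do ?[by apply: sX; rewrite !inE eqxx ?orbT].
apply: eq_bigr => g _; rewrite scaler_sumr; apply: eq_bigr => h _ /=.
by rewrite -monomialZ -skew_coefZr//; exact: coef_in.
Qed.

Lemma skew_mul_delta g h a b (Da : D g a) (Db : D h b) :
  skew_mul (delta Da) (delta Db) = delta (skew_coef_in Da Db).
Proof.
apply: val_inj => /=.
have sub k c : coef_supp (monomial k c) `<=` [set` [:: k]].
  move=> l /=; rewrite inE; apply: contra_neqT => /negPf.
  by rewrite /monomial => ->.
rewrite -[LHS]/(skew_mul (delta Da) (delta Db) : G -> A).
rewrite (@skew_mulE _ _ [:: g] [:: h])// ?big_seq1; try exact: sub.
by rewrite /= /monomial !eqxx.
Qed.

End SkewGroupRing.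

Definition strongly_associative {K : fieldType} (A : nuAlgType K) : Prop :=
  forall (G : groupType) (alpha : partial_action G A),
    associative (@skew_mul K G A alpha).

(* Main.v *)
Require Import Defs.
From mathcomp Require Import all_boot all_order all_algebra.
From mathcomp Require Import boolp classical_sets functions cardinality.

(* On homogeneous elements, associativity amounts to
   alpha_h (alpha_h^-1 (u b) c) = u alpha_h (alpha_h^-1 (b) c) for b in D_h:
   left multiplication by u commutes on D_h with the right multiplication by c
   transported along alpha_h.  Both sides lie in D_h and agree after left
   multiplication by any d in D_h, because d u is in D_h and the transported map
   is a morphism of left D_h-modules.  Their difference thus lies in the right
   annihilator of D_h inside D_h, an ideal of square zero, which semiprimeness
   forces to vanish. *)

Set Implicit Arguments.
Unset Strict Implicit.
Unset Printing Implicit Defensive.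
Import GRing.Theory.
(* [all_algebra] shadows [idealMr] with its namesake in [ring_quotient]. *)
Import Defs.
Local Open Scope classical_set_scope.
Local Open Scope ring_scope.

Section Annihilator.
Context {K : fieldType} {A : nuAlgType K}.

Lemma amulrB (x y z : A) : x ** (y - z) = x ** y - x ** z.
Proof. by apply: (canRL (addrK _)); rewrite -amulDr subrK. Qed.

Lemma idealB (I : set A) x y : is_ideal I -> I x -> I y -> I (x - y).
Proof.
by move=> iI Ix Iy; rewrite -scaleN1r; apply: idealD => //; apply: idealZ.
Qed.

Definition inner_rann (I : set A) : set A :=
  [set z | I z /\ forall d, I d -> d ** z = 0].

Lemma inner_rann_ideal (I : set A) : is_ideal I -> is_ideal (inner_rann I).
Proof.
move=> iI; split.
- by split=> [|d _]; [exact: ideal0|rewrite amulr0].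
- move=> x y [Ix x0] [Iy y0]; split; first exact: idealD.
  by move=> d Id; rewrite amulDr x0// y0// addr0.
- move=> c x [Ix x0]; split; first exact: idealZ.
  by move=> d Id; rewrite -ascalerAr x0// scaler0.
- move=> a x [Ix x0]; split; first exact: idealMl.
  (* As [I] is two-sided, [d ** a] is again in [I] and so kills [x]. *)
  by move=> d Id; rewrite amulA x0//; exact: idealMr.
- move=> a x [Ix x0]; split; first exact: idealMr.
  by move=> d Id; rewrite amulA x0// amul0r.
Qed.

Lemma inner_rann_nilpotent (I : set A) : nilpotent_ideal (inner_rann I).
Proof.
(* Index 1 means the square: in each product the left factor lies in [I] and the right one is killed
   by [I]. *)
exists 1%N; apply/seteqP; split=> x /=.
  case=> s [sI ->]; rewrite big_seq big1// => p /sI[[Ip _] [_ p0]].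
  exact: p0.
by move=> ->; exists [::]; rewrite big_nil.
Qed.

Lemma semiprime_cancel (I : set A) x y : semiprime A -> is_ideal I ->
  I x -> I y -> (forall d, I d -> d ** x = d ** y) -> x = y.
Proof.
move=> [_ sA] iI Ix Iy xy; apply/eqP; rewrite -subr_eq0; apply/eqP.
have : inner_rann I (x - y).
  split; first exact: idealB.
  by move=> d Id; rewrite amulrB xy// subrr.
rewrite (sA (inner_rann I))//; first exact: inner_rann_ideal.
exact: inner_rann_nilpotent.
Qed.

End Annihilator.

Section PartialAction.
Context {K : fieldType} {G : groupType} {A : nuAlgType K}.
Variable alpha : partial_action G A.
Implicit Types g h k : G.
Local Notation D := (pdom alpha).
Local Notation act := (pact alpha).

Lemma pactVK g x : D g x -> act g (act g^-1%g x) = x.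
Proof.
move=> Dx; rewrite pactM ?mulgV ?pact1//.
by split; rewrite ?invgK//; split; exact: pactV_in.
Qed.

Lemma pactKV g x : D g^-1%g x -> act g^-1%g (act g x) = x.
Proof. by move=> Dx; rewrite -{2}[g]invgK pactVK. Qed.

Lemma pact_mul g x y : D g^-1%g x -> D g^-1%g y ->
  act g (x ** y) = act g x ** act g y.
Proof. exact: (isoM (pact_iso alpha g)). Qed.

(** The composition axiom at alpha_h^-1(x): its domain condition becomes membership of [x] in both
    ideals. *)
Lemma pactMV g h x : D h x -> D g^-1%g x ->
  act (g * h)%g (act h^-1%g x) = act g x.
Proof.
move=> Dhx Dgx; have Vx := pactV_in Dhx.
by rewrite -pactM ?pactVK//; split=> //=; rewrite pactVK.
Qed.

Lemma pactV_dom g h x : D h x -> D g^-1%g x -> D (g * h)^-1%g (act h^-1%g x).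
Proof.
move=> Dhx Dgx; apply: (@pact_pre_sub _ _ _ alpha).
by split=> /=; [exact: pactV_in|rewrite pactVK].
Qed.

(* [skew_coef h 1 b c] is alpha_h (alpha_h^-1 (b) c), that is, right
   multiplication by [c] transported to [D h], applied to [b]. *)
Lemma skew_coef1_in h b c : D h b -> D h (skew_coef alpha h 1%g b c).
Proof.
move=> Db; apply: pact_in; apply: idealMr (pactV_in Db).
exact: pdom_ideal.
Qed.

(** alpha_h^-1 is multiplicative only on D_h, whence the restriction on [d]. *)
Lemma skew_coef1Ml h d b c : D h d -> D h b ->
  skew_coef alpha h 1%g (d ** b) c = d ** skew_coef alpha h 1%g b c.
Proof.
move=> Dd Db; rewrite /skew_coef (@pact_mul h^-1%g) ?invgK//.
rewrite -amulA pact_mul ?pactVK//; first exact: pactV_in.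
by apply: idealMr (pactV_in Db); exact: pdom_ideal.
Qed.

Lemma skew_coef1_Lmul h u b c : semiprime A -> D h b ->
  skew_coef alpha h 1%g (u ** b) c = u ** skew_coef alpha h 1%g b c.
Proof.
move=> sA Db; have iD := pdom_ideal alpha h.
have Dub : D h (u ** b) by exact: idealMl.
apply: (semiprime_cancel sA iD) => [||d Dd].
- exact: skew_coef1_in.
- by apply: idealMl => //; exact: skew_coef1_in.
(* [d] moves inside, is absorbed into [d ** u], and this element of D_h moves out again. *)
- have Ddu : D h (d ** u) by exact: idealMr.
  by rewrite -skew_coef1Ml// !amulA skew_coef1Ml.
Qed.

Lemma skew_coefA g h k a b c : semiprime A -> D g a -> D h b -> D k c ->
  skew_coef alpha (g * h)%g k (skew_coef alpha g h a b) c =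
  skew_coef alpha g (h * k)%g a (skew_coef alpha h k b c).
Proof.
move=> sA Da Db Dc; rewrite [RHS]/skew_coef.
(* The two terms are convertible; the second is the transported right multiplication. *)
rewrite -[skew_coef alpha h k b c]/(skew_coef alpha h 1%g b c).
rewrite -skew_coef1_Lmul//; set u := act g^-1%g a.
have Du : D g^-1%g u by exact: pactV_in.
have Dgub : D g^-1%g (u ** b) by apply: idealMr Du; exact: pdom_ideal.
have Dhub : D h (u ** b) by apply: idealMl Db; exact: pdom_ideal.
have Vub := pactV_dom Dhub Dgub.
(* Writing alpha_g(u b) as alpha_(gh)(alpha_h^-1(u b)) cancels alpha_(gh)^-1; what remains is
   alpha_(gh)(v) = alpha_g(alpha_h(v)). *)
rewrite /skew_coef -/u -(pactMV Dhub Dgub) pactKV//.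
set v := act h^-1%g (u ** b) ** c.
have Dv : D h^-1%g v by apply: idealMr (pactV_in Dhub); exact: pdom_ideal.
have Dghv : D (g * h)^-1%g v by apply: idealMr Vub; exact: pdom_ideal.
have Dgv : D g^-1%g (act h v).
  (* The domain axiom for the pair gh, h^-1, whose product is g. *)
  by have := pactV_dom Dv Dghv; rewrite mulgK invgK.
by rewrite -[X in act (g * h)%g X](pactKV Dv) pactMV//; exact: pact_in.
Qed.

End PartialAction.

Section SkewRing.
Context {K : fieldType} {G : groupType} {A : nuAlgType K}.
Variable alpha : partial_action G A.
Local Notation mul := (@skew_mul K G A alpha).

Lemma skew_mul0l y : mul 0 y = 0.
Proof. by rewrite -(scale0r 0) skew_mulZl !scale0r. Qed.

Lemma skew_mul0r x : mul x 0 = 0.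
Proof. by rewrite -(scale0r 0) skew_mulZr !scale0r. Qed.

Lemma skew_ring_sum_delta (x : skew_ring alpha) :
  exists s : seq G, x = \sum_(g <- s) delta (coef_in x g).
Proof.
have [s us sx] := coef_supp_seq [:: x]; exists s; apply: val_inj.
rewrite raddf_sum; apply/funext => k; rewrite fct_sumE /= /monomial.
have [ks|kNs] := boolP (k \in s).
  rewrite (big_rem k)//= eqxx big_seq big1 ?addr0// => g.
  by rewrite mem_rem_uniq// inE eq_sym => /andP[/negPf->].
rewrite big_seq big1.
  by apply: contraNeq kNs => xk; apply: (sx x); rewrite ?inE.
by move=> g gs; case: eqP => // kg; rewrite kg gs in kNs.
Qed.

(** Reduces identities additive in each argument to homogeneous elements. *)
Lemma skew_ring_delta_ind (P : skew_ring alpha -> Prop) :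
  P 0 -> (forall x y, P x -> P y -> P (x + y)) ->
  (forall g a (Da : pdom alpha g a), P (delta Da)) -> forall x, P x.
Proof.
move=> P0 PD Pdelta x; have [s ->] := skew_ring_sum_delta x.
exact: big_ind.
Qed.

Lemma skew_mul_deltaA g h k a b c (Da : pdom alpha g a)
    (Db : pdom alpha h b) (Dc : pdom alpha k c) : semiprime A ->
  mul (delta Da) (mul (delta Db) (delta Dc)) =
  mul (mul (delta Da) (delta Db)) (delta Dc).
Proof.
(* [val_inj] discards the membership proofs carried by [delta]. *)
move=> sA; rewrite !skew_mul_delta; apply: val_inj => /=.
by rewrite skew_coefA// mulgA.
Qed.

End SkewRing.

Theorem corollary3p4 (K : fieldType) (A : nuAlgType K) :
  semiprime A -> strongly_associative A.
Proof.
move=> sA G alpha x y z.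
elim/(@skew_ring_delta_ind _ _ _ alpha): x => [|x x' IH IH'|g a Da].
- by rewrite !skew_mul0l.
- by rewrite !skew_mulDl IH IH'.
elim/(@skew_ring_delta_ind _ _ _ alpha): y => [|y y' IH IH'|h b Db].
- by rewrite !(skew_mul0l, skew_mul0r).
- by rewrite !(skew_mulDl, skew_mulDr) IH IH'.
elim/(@skew_ring_delta_ind _ _ _ alpha): z => [|z z' IH IH'|k c Dc].
- by rewrite !skew_mul0r.
- by rewrite !skew_mulDr IH IH'.
exact: skew_mul_deltaA.
Qed.
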